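(* The following assertion is false: ''Let $W\colon \mathrm{GL}^+(2)\to\mathbb{R}\cup\{+\infty\}$ be an objective, isotropic and rank-one convex function such that for every $c\in\mathbb{R}$ the sublevel set $S_c=\{F\in\mathbb{R}^{2\times 2} : \det F>0,\ W(F)\le c\}$ is connected and compact. Then $W$ is polyconvex.'' In other words, there exists an objective, isotropic and rank-one convex function $W\colon \mathrm{GL}^+(2)\to\mathbb{R}\cup\{+\infty\}$, all of whose sublevel sets $S_c$, $c\in\mathbb{R}$, are connected and compact, such that $W$ is not polyconvex.
   Context: $\mathrm{GL}^+(2)=\{F\in\mathbb{R}^{2\times2} : \det F>0\}$ and $\mathrm{SO}(2)$ is the special orthogonal group. A function $W\colon\mathrm{GL}^+(2)\to\mathbb{R}\cup\{+\infty\}$ is called: (1) objective and isotropic if $W(Q_1FQ_2)=W(F)$ for all $F\in\mathrm{GL}^+(2)$ and all $Q_1,Q_2\in\mathrm{SO}(2)$; (2) rank-one convex if $W((1-t)F+t(F+H))\le(1-t)W(F)+tW(F+H)$ for all $t\in[0,1]$, all $F\in\mathrm{GL}^+(2)$ and all $H\in\mathbb{R}^{2\times2}$ with $\operatorname{rank}(H)=1$ and $F+H\in\mathrm{GL}^+(2)$ (the whole segment then lies in $\mathrm{GL}^+(2)$, since $\det$ is affine along rank-one directions); (3) polyconvex if there exists a convex function $P\colon\mathbb{R}^{2\times2}\times\mathbb{R}\cong\mathbb{R}^5\to\mathbb{R}\cup\{+\infty\}$ such that $W(F)=P(F,\det F)$ for all $F\in\mathrm{GL}^+(2)$. The empty set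 is regarded as connected and compact. *)

(* Defs.v *)
From HB Require Import structures.
From mathcomp Require Import all_boot all_order all_algebra.
From mathcomp Require Import all_classical all_reals all_analysis.

Set Implicit Arguments.
Unset Strict Implicit.
Unset Printing Implicit Defensive.

Import Order.TTheory GRing.Theory Num.Theory.
Import numFieldNormedType.Exports.

Local Open Scope classical_set_scope.
Local Open Scope ring_scope.

Definition GLplus2 (R : realType) : set 'M[R]_2 := [set F | 0 < \det F].

Definition SO2 (R : realType) : set 'M[R]_2 :=
  [set Q | Q *m Q^T = 1%:M /\ \det Q = 1].

(* A function W : GL+(2) -> R \cup {+oo} is represented by a total function
   W : 'M[R]_2 -> \bar R.  Every predicate below only looks at the values of W
   on [GLplus2 R]; values elsewhere are irrelevant. *)

Definition no_ninfty_on (R : realType) (T : Type) (D : set T)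
    (f : T -> \bar R) : Prop :=
  forall x, D x -> f x <> -oo%E.

Definition objective_isotropic (R : realType) (W : 'M[R]_2 -> \bar R) : Prop :=
  forall F Q1 Q2 : 'M[R]_2, GLplus2 F -> SO2 Q1 -> SO2 Q2 ->
    W (Q1 *m F *m Q2) = W F.

(* In \bar R, 0 * +oo = 0, the usual convention of convex analysis; at t = 0
   and t = 1 the inequalities below are then equalities. *)

Definition rank_one_convex (R : realType) (W : 'M[R]_2 -> \bar R) : Prop :=
  forall (t : R) (F H : 'M[R]_2), 0 <= t <= 1 ->
    GLplus2 F -> \rank H = 1%N -> GLplus2 (F + H) ->
    (W (((1 - t) *: F + t *: (F + H))%R)
       <= (1 - t)%:E * W F + t%:E * W (F + H)%R)%E.

(* [convex_function] of MathComp-Analysis only covers real-valued functions. *)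
Definition ext_convex (R : realType) (E : lmodType R) (f : E -> \bar R) : Prop :=
  forall (t : R) (x y : E), 0 <= t <= 1 ->
    (f (((1 - t) *: x + t *: y)%R) <= (1 - t)%:E * f x + t%:E * f y)%E.

Definition polyconvex (R : realType) (W : 'M[R]_2 -> \bar R) : Prop :=
  exists P : 'M[R]_2 * R^o -> \bar R,
    [/\ no_ninfty_on setT P,
        ext_convex P
      & forall F : 'M[R]_2, GLplus2 F -> W F = P (F, \det F)].

Definition sublevel (R : realType) (W : 'M[R]_2 -> \bar R) (c : R) :
    set 'M[R]_2 :=
  [set F | 0 < \det F /\ (W F <= c%:E)%E].

(* Main.v *)
(* Identify a planar matrix with a pair (z, w) of complex numbers through
   F x = z x + w (conj x); then det F = |z|^2 - |w|^2, isotropic functions are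
   the functions of |z| and |w|, and rank-one matrices are those with |z| = |w|.
   The set K of all F with 4 |w| <= det F - 1 and |z| <= 5 is compact, connected
   and cut out by convex conditions on (F, det F).  Its face {det F = 1} is SO(2),
   and no rank-one segment joins SO(2) to K \ SO(2).  Hence the function W equal
   to 0 on SO(2), to 1 on K \ SO(2) and to +oo elsewhere is rank-one convex.  It
   is not polyconvex: (3 I, 9) is a convex combination of the pairs (F, det F)
   for F = I, 5 I, diag(4, 2) and diag(2, 4), with weights 1/10, 1/10, 2/5, 2/5,
   whereas W(3 I) = 1 and W(I) = 0. *)
Require Import Defs.
From HB Require Import structures.
From mathcomp Require Import all_boot all_order all_algebra.
From mathcomp Require Import all_classical all_reals all_analysis.
From mathcomp Require Import ring lra.

Import Order.TTheory GRing.Theory Num.Theory.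
Import numFieldNormedType.Exports.

Local Open Scope classical_set_scope.
Local Open Scope ring_scope.

(** * Topology of matrix spaces *)

Section mx_topology.
Context {R : realType}.

Lemma mx_continuous (T : topologicalType) (m n : nat) (f : T -> 'M[R]_(m, n)) :
  (forall i j, continuous (fun x => f x i j)) -> continuous f.
Proof.
move=> cf x; apply/cvg_ballP => e e0.
have : \forall y \near x, forall ij : 'I_m * 'I_n,
    ball (f x ij.1 ij.2) e (f y ij.1 ij.2).
  by apply: filter_forall => ij; move: (cf ij.1 ij.2 x) => /cvg_ballP; exact.
by apply: filterS => y fy; split => // i j; exact: (fy (i, j)).
Qed.

(** [vec_mx] carries a compact cube of row vectors onto the matrices with entries in [[-r, r]], and
    [A] is a closed subset of that image. *)
Lemma bounded_closed_mx_compact (m n : nat) (r : R) (A : set 'M[R]_(m, n)) :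
  closed A -> (forall M, A M -> forall i j, `|M i j| <= r) -> compact A.
Proof.
move=> clA bA.
pose B := [set v : 'rV[R]_(m * n) | forall k, `[-r, r]%classic (v ord0 k)].
have cB : compact B.
  exact: (@rV_compact _ _ (fun=> `[-r, r]%classic)
    (fun=> @segment_compact R (- r) r)).
have cvec : continuous (fun v : 'rV[R]_(m * n) => vec_mx v : 'M[R]_(m, n)).
  apply: mx_continuous => i j v.
  under eq_fun do rewrite mxE.
  exact: coord_continuous.
apply: (subclosed_compact clA (continuous_compact
  (continuous_subspaceT cvec) cB)) => M /bA bM.
exists (mxvec M); last by rewrite mxvecK.
by move=> k /=; case/mxvec_indexP: k => i j; rewrite mxvecE in_itv /= -ler_norml.
Qed.

End mx_topology.

Lemma path_connected_component (R : realType) (T : topologicalType)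
    (I : set R) (f : R -> T) (A : set T) (a b : R) :
  connected I -> continuous f -> (forall t, I t -> A (f t)) -> I a -> I b ->
  connected_component A (f a) (f b).
Proof.
move=> cI cf fA Ia Ib; exists (f @` I); last by exists b.
split; first by exists a.
  by move=> _ [t It <-]; exact: fA.
exact/(connected_continuous_connected cI)/continuous_subspaceT.
Qed.

(** * Determinant, Frobenius norm and the witness *)

Section planar.
Context {R : realType}.
Implicit Types F G H : 'M[R]_2.

Definition fro2 F : R := \tr (F *m F^T).

Lemma det22 F : \det F = F 0 0 * F 1 1 - F 0 1 * F 1 0.
Proof.
rewrite (expand_det_row _ 0) !big_ord_recl big_ord0 addr0 /cofactor !det_mx11.
rewrite !mxE /= expr0 expr1 mul1r mulN1r mulrN.
by congr (F _ _ * F _ _ - F _ _ * F _ _); apply/val_inj.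
Qed.

Lemma fro2E F :
  fro2 F = F 0 0 ^+ 2 + F 0 1 ^+ 2 + F 1 0 ^+ 2 + F 1 1 ^+ 2.
Proof.
rewrite /fro2 /mxtrace !(big_ord_recl, big_ord0) !mxE.
rewrite !(big_ord_recl, big_ord0) !mxE !addr0 -!expr2 !addrA.
by congr (_ + F _ _ ^+ 2 + F _ _ ^+ 2 + F _ _ ^+ 2); apply/val_inj.
Qed.

Lemma coord_mul_continuous (i j k l : 'I_2) :
  continuous (fun F => F i j * F k l).
Proof.
by move=> F; exact: (cvgM (@coord_continuous R _ _ i j F)
  (@coord_continuous R _ _ k l F)).
Qed.

Lemma det_continuous : continuous (fun F => \det F).
Proof.
rewrite (_ : (fun F => _) = fun F => F 0 0 * F 1 1 - F 0 1 * F 1 0); last first.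
  by apply/funext => F; exact: det22.
by move=> F; exact: (cvgB (coord_mul_continuous _ _ _ _ _)
  (coord_mul_continuous _ _ _ _ _)).
Qed.

Lemma fro2_continuous : continuous fro2.
Proof.
rewrite (_ : fro2 = fun F => F 0 0 * F 0 0 + F 0 1 * F 0 1 + F 1 0 * F 1 0
    + F 1 1 * F 1 1); last first.
  by apply/funext => F; rewrite fro2E -!expr2.
by move=> F; exact: (cvgD (cvgD (cvgD (coord_mul_continuous _ _ _ _ _)
  (coord_mul_continuous _ _ _ _ _)) (coord_mul_continuous _ _ _ _ _))
  (coord_mul_continuous _ _ _ _ _)).
Qed.

Lemma SO2_invariant F Q1 Q2 : SO2 Q1 -> SO2 Q2 ->
  \det (Q1 *m F *m Q2) = \det F /\ fro2 (Q1 *m F *m Q2) = fro2 F.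
Proof.
move=> [Q1T d1] [Q2T d2]; split; first by rewrite !det_mulmx d1 d2 mul1r mulr1.
have Q1T' : Q1^T *m Q1 = 1%:M by apply: mulmx1C.
rewrite /fro2 !trmx_mul -(mulmxA _ Q2) (mulmxA Q2) Q2T mul1mx.
by rewrite -mulmxA mxtrace_mulC !mulmxA -!mulmxA Q1T' mulmx1.
Qed.

(* fro2 F = 2 (|z|^2 + |w|^2): the last two conditions are |z| <= 5 and
   4 |w| <= det F - 1. *)
Definition body F : Prop :=
  [/\ 1 <= \det F, fro2 F + 2 * \det F <= 100
    & 4 * (fro2 F - 2 * \det F) <= (\det F - 1) ^+ 2].

(** This is SO(2) as a face of [body]: invariance and closedness come directly from those of [\det]
    and [fro2]. *)
Definition rotations F : Prop := body F /\ \det F = 1.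

Definition witness F : \bar R :=
  if `[< rotations F >] then 0%E else if `[< body F >] then 1%E else +oo%E.


Lemma witness_rotations F : rotations F -> witness F = 0%E.
Proof. by move=> rF; rewrite /witness asboolT. Qed.

Lemma witness_body F : body F -> \det F != 1 -> witness F = 1%E.
Proof.
move=> bF /eqP dF; rewrite /witness asboolF ?asboolT//.
by move=> [_].
Qed.

Lemma witness_out F : ~ body F -> witness F = +oo%E.
Proof. by move=> bF; rewrite /witness !asboolF// => -[]. Qed.

Lemma witness_le1 F : body F -> (witness F <= 1)%E.
Proof.
move=> bF; have [dF|dF] := eqVneq (\det F) 1; last by rewrite witness_body.
by rewrite witness_rotations ?lee01.
Qed.

Lemma witness_ge0 F : (0 <= witness F)%E.
Proof. by rewrite /witness; case: ifP => // _; case: ifP. Qed.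

(** * Rank-one segments in the body *)

Lemma det_segment F H (t : R) : \det H = 0 ->
  \det ((1 - t) *: F + t *: (F + H)) = (1 - t) * \det F + t * \det (F + H).
Proof. by rewrite !det22 !mxE => /subr0_eq detH; ring: detH. Qed.

(** Convexity of the cone |v| <= a in squared form, so that no square root is needed. The cross term
    is bounded by Cauchy-Schwarz. *)
Lemma cone_convex (x y a x' y' a' t : R) : 0 <= t <= 1 -> 0 <= a -> 0 <= a' ->
  x ^+ 2 + y ^+ 2 <= a ^+ 2 -> x' ^+ 2 + y' ^+ 2 <= a' ^+ 2 ->
  ((1 - t) * x + t * x') ^+ 2 + ((1 - t) * y + t * y') ^+ 2
    <= ((1 - t) * a + t * a') ^+ 2.
Proof.
move=> /andP[t0 t1] a0 a'0 xa xa'.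
have dot_le : x * x' + y * y' <= a * a'.
  apply: le_trans (ler_norm _) _; rewrite -(ler_pXn2r (n := 2))// ?nnegrE//.
    rewrite real_normK ?num_real// exprMn.
    have := ler_pM (addr_ge0 (sqr_ge0 x) (sqr_ge0 y))
      (addr_ge0 (sqr_ge0 x') (sqr_ge0 y')) xa xa'.
    by have := sqr_ge0 (x * y' - y * x'); lra.
  exact: mulr_ge0.
have tt : 0 <= t * (1 - t) by rewrite mulr_ge0// subr_ge0.
have := ler_wpM2l tt dot_le.
have := ler_wpM2l (sqr_ge0 t) xa'.
have := ler_wpM2l (sqr_ge0 (1 - t)) xa.
by lra.
Qed.

(** All three conditions are convex in the pair (F, det F), and det is affine along the segment
    because det H = 0. *)
Lemma body_segment F H (t : R) : 0 <= t <= 1 -> \det H = 0 ->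
  body F -> body (F + H) -> body ((1 - t) *: F + t *: (F + H)).
Proof.
move=> t01 detH [d1 z1 w1] [d2 z2 w2].
move: (t01) => /andP[t0 t1].
have := det_segment F H t detH.
set G := (1 - t) *: F + t *: (F + H) => detG.
have GE i j : G i j = (1 - t) * F i j + t * (F + H) i j by rewrite !mxE.
split.
- by rewrite detG; nra.
(* The vector is 2 z in real coordinates, hence the radius 10 for |z| <= 5. *)
- have := @cone_convex (F 0 0 + F 1 1) (F 1 0 - F 0 1) 10
    ((F + H) 0 0 + (F + H) 1 1) ((F + H) 1 0 - (F + H) 0 1) 10 t t01.
  move: z1 z2; rewrite !fro2E !det22 !GE.
  move: ((F + H) _ _) ((F + H) _ _) ((F + H) _ _) ((F + H) _ _) => a b c d.
  move: (F _ _) (F _ _) (F _ _) (F _ _) => a' b' c' d' z1 z2 cc.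
  have /cc : 0 <= 10 :> R by lra.
  move=> {}cc; have /cc {}cc : 0 <= 10 :> R by lra.
  have := cc ltac:(lra) ltac:(lra); lra.
(* The vector is 2 w, and 4 |w| <= det F - 1 reads |2 w| <= (det F - 1) / 2. *)
- have := @cone_convex (F 0 0 - F 1 1) (F 1 0 + F 0 1) ((\det F - 1) / 2)
    ((F + H) 0 0 - (F + H) 1 1) ((F + H) 1 0 + (F + H) 0 1)
    ((\det (F + H) - 1) / 2) t t01.
  have := det22 G; rewrite detG.
  move: d1 d2 w1 w2 (det22 F) (det22 (F + H)); rewrite !fro2E !GE.
  move: (\det F) (\det (F + H)).
  move: ((F + H) _ _) ((F + H) _ _) ((F + H) _ _) ((F + H) _ _) => a b c d.
  move: (F _ _) (F _ _) (F _ _) (F _ _) => a' b' c' d' D D' d1 d2 w1 w2 E1 E2 E3.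
  move=> /(_ ltac:(lra) ltac:(lra)) cc.
  have := cc ltac:(lra) ltac:(lra); lra.
Qed.

(** At det F = 1 the last condition of [body] forces w = 0. *)
Lemma rotations_entries F : rotations F -> F 1 1 = F 0 0 /\ F 0 1 = - F 1 0.
Proof.
move=> [[_ _ w] d]; move: w (det22 F); rewrite fro2E d => w E.
have w0 : (F 0 0 - F 1 1) ^+ 2 + (F 1 0 + F 0 1) ^+ 2 <= 0 by lra.
have /andP[eF oF] : (F 0 0 - F 1 1 == 0) && (F 1 0 + F 0 1 == 0).
  by rewrite -sqrf_eq0 -(sqrf_eq0 (_ + _)) -paddr_eq0 ?sqr_ge0// eq_le w0
    addr_ge0 ?sqr_ge0.
split; first by apply/esym/eqP; rewrite -subr_eq0.
by apply/eqP; rewrite -addr_eq0 addrC.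
Qed.

(* Along a rank-one direction H = (h, k) one has |h| = |k|, so leaving a
   rotation (z, 0) gives det - 1 = 2 Re (conj z h) <= 2 |k|, which is
   incompatible with 4 |k| <= det - 1 unless det = 1. *)
Lemma rotations_isolated F G :
  rotations F -> body G -> \det (G - F) = 0 -> \det G = 1.
Proof.
move=> rF [_ _ w2] dGF; have [eF oF] := rotations_entries F rF.
case: rF => _ d1.
suff : (\det G - 1) ^+ 2 <= 0.
  by rewrite le_eqVlt ltNge sqr_ge0 orbF sqrf_eq0 subr_eq0 => /eqP.
move: dGF d1; rewrite !det22 !mxE eF oF.
move: w2 (det22 G); rewrite fro2E.
move: (\det G) (F 0 0) (F 1 0) => D c s.
move: (G _ _) (G _ _) (G _ _) (G _ _) => a b e d w2 DE dGF d1.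
(* Here (x, y) is 2 h. [E1] is det G - 1 = 2 Re (conj z h), and [E2] is |h| = |k| multiplied by 2
   and squared. *)
pose x := a + d - 2 * c; pose y := b - e - 2 * s.
have E1 : D - 1 = c * x + s * y.
  rewrite DE /x /y; lra.
have E2 : x ^+ 2 + y ^+ 2 = (a - d) ^+ 2 + (e + b) ^+ 2.
  rewrite /x /y; lra.
have : (D - 1) ^+ 2 <= x ^+ 2 + y ^+ 2.
  rewrite E1.
  have -> : x ^+ 2 + y ^+ 2 = (c ^+ 2 + s ^+ 2) * (x ^+ 2 + y ^+ 2).
    by rewrite (_ : c ^+ 2 + s ^+ 2 = 1) ?mul1r; last lra.
  have := sqr_ge0 (c * y - s * x); lra.
by rewrite -DE E2; lra.
Qed.


(** * Invariance and rank-one convexity of the witness *)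

Lemma witness_objective_isotropic : objective_isotropic witness.
Proof.
move=> F Q1 Q2 _ oQ1 oQ2; have [dE fE] := SO2_invariant F Q1 Q2 oQ1 oQ2.
by rewrite /witness /rotations /body dE fE.
Qed.

Lemma det_rank1 H : \rank H = 1%N -> \det H = 0.
Proof.
move=> rH; apply/eqP; have := unitmxE H.
by rewrite -row_full_unit /row_full rH unitfE => /esym/negbFE.
Qed.

Lemma witness_rank_one_convex : rank_one_convex witness.
Proof.
move=> t F H t01 _ /det_rank1 detH _; case/andP: (t01) => t0 t1.
have t1' : 0 <= 1 - t by rewrite subr_ge0.
(* The ends t = 0 and t = 1 go first, since 0 * +oo = 0. Afterwards both weights are positive, so an
   endpoint outside [body] makes the right-hand side +oo. *)
have [->|tN0] := eqVneq t 0.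
  by rewrite subr0 !scale1r scale0r addr0 mul0e adde0 mul1e.
have [->|tN1] := eqVneq t 1.
  by rewrite subrr !scale1r scale0r add0r mul0e add0e mul1e.
have tpos : (0 < t%:E)%E by rewrite lte_fin lt_neqAle eq_sym tN0.
have tpos' : (0 < (1 - t)%:E)%E by rewrite lte_fin subr_gt0 lt_neqAle tN1.
have pos r G : (0 < r%:E)%E -> (r%:E * witness G != -oo)%E.
  by move=> r0; rewrite gt_eqF// (lt_le_trans ltNy0)// mule_ge0 ?witness_ge0// ltW.
have [bF|nF] := pselect (body F); last first.
  by rewrite (witness_out F nF) gt0_muley// addye ?pos// leey.
have [bG|nG] := pselect (body (F + H)); last first.
  by rewrite (witness_out (F + H) nG) gt0_muley// addey ?pos// leey.
have bS := body_segment F H t t01 detH bF bG.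
(* If one endpoint is a rotation then so is the other, and det = 1 on the whole segment; otherwise
   both endpoints have value 1. *)
have [dF|dF] := eqVneq (\det F) 1.
  have dG : \det (F + H) = 1.
    by apply: (rotations_isolated F) => //; rewrite addrAC subrr add0r.
  rewrite witness_rotations ?adde_ge0 ?mule_ge0 ?lee_fin ?witness_ge0//.
  by split => //; rewrite det_segment// dF dG !mulr1 subrK.
have [dG|dG] := eqVneq (\det (F + H)) 1.
  move: dF; rewrite (rotations_isolated (F + H) F) ?eqxx//.
  by rewrite opprD addrA subrr add0r -scaleN1r detZ detH mulr0.
by rewrite (witness_body F)// (witness_body (F + H))// !mule1 -EFinD subrK
  witness_le1.
Qed.

(** * Compactness *)

Lemma closed_body : closed body.
Proof.
have -> : body = [set F | 1 <= \det F] `&`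
    ([set F | fro2 F + 2 * \det F <= 100] `&`
     [set F | 4 * (fro2 F - 2 * \det F) - (\det F - 1) ^+ 2 <= 0]).
  by apply/seteqP; split => F; rewrite /body /= subr_le0; [case|case=> ? []].
have cd2 : continuous (fun F : 'M[R]_2 => 2 * \det F).
  by move=> F; exact: (cvgM (@cvg_cst _ _ _ _ _) (det_continuous F)).
apply: closedI; last apply: closedI.
- exact: (closed_comp (fun F _ => det_continuous F) (@closed_ge R 1)).
- apply: (closed_comp (f := fun F => fro2 F + 2 * \det F) _ (@closed_le R 100)).
  by move=> F _; exact: (cvgD (fro2_continuous F) (cd2 F)).
- apply: (closed_comp
    (f := fun F => 4 * (fro2 F - 2 * \det F) - (\det F - 1) ^+ 2)
    _ (@closed_le R 0)).
  move=> F _.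
  have cw : (fun F => fro2 F - 2 * \det F) @ F --> fro2 F - 2 * \det F.
    exact: (cvgB (fro2_continuous F) (cd2 F)).
  have cw4 : (fun F => 4 * (fro2 F - 2 * \det F)) @ F
      --> 4 * (fro2 F - 2 * \det F).
    exact: (cvgM (@cvg_cst _ _ _ _ _) cw).
  have cd1 : (fun F => \det F - 1) @ F --> \det F - 1.
    exact: (cvgB (det_continuous F) (@cvg_cst _ _ _ _ _)).
  exact: (cvgB cw4 (cvgM cd1 cd1)).
Qed.

(** Since det F > 0, the bound on [fro2 F + 2 * \det F] already gives [fro2 F <= 100]. *)
Lemma body_entry F : body F -> forall i j, `|F i j| <= 10.
Proof.
move=> [d z _] i j.
have le_fro : F i j ^+ 2 <= fro2 F.
  rewrite /fro2 /mxtrace (bigD1 i)//= mxE (bigD1 j)//= !mxE -expr2 -addrA lerDl.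
  apply: addr_ge0; first by apply: sumr_ge0 => k _; rewrite mxE -expr2 sqr_ge0.
  by apply: sumr_ge0 => k _; rewrite mxE; apply: sumr_ge0 => l _;
    rewrite mxE -expr2 sqr_ge0.
rewrite -(ler_pXn2r (n := 2))// ?nnegrE// real_normK ?num_real//.
by move: le_fro; lra.
Qed.

Lemma compact_body : compact body.
Proof. exact: (bounded_closed_mx_compact _ _ 10 _ closed_body body_entry). Qed.

Lemma compact_rotations : compact rotations.
Proof.
apply: (bounded_closed_mx_compact _ _ 10); last by move=> F [/body_entry].
apply: closedI closed_body _.
exact: (closed_comp (fun F _ => det_continuous F) (@closed_eq R 1)).
Qed.


(** * Connectedness *)

(** Multiplication by the complex number c + i s, that is, the pair (c + i s, 0). *)
Definition conformal (c s : R) : 'M[R]_2 :=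
  \matrix_(i, j) if i == j then c else if (i < j)%N then - s else s.

Lemma det_conformal (c s : R) : \det (conformal c s) = c ^+ 2 + s ^+ 2.
Proof. by rewrite det22 !mxE /=; ring. Qed.

Lemma body_conformal (c s : R) :
  1 <= c ^+ 2 + s ^+ 2 <= 25 -> body (conformal c s).
Proof.
move=> /andP[r1 r25]; have fE : fro2 (conformal c s) = 2 * (c ^+ 2 + s ^+ 2).
  by rewrite fro2E !mxE /=; ring.
rewrite /body fE det_conformal; split => //; first by lra.
by rewrite subrr mulr0 sqr_ge0.
Qed.

Lemma rotations_conformal (c s : R) :
  c ^+ 2 + s ^+ 2 = 1 -> rotations (conformal c s).
Proof.
by move=> cs; split; [apply: body_conformal; rewrite cs; lra|rewrite det_conformal].
Qed.

Lemma rotationsE F : rotations F ->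
  F = conformal (F 0 0) (F 1 0) /\ F 0 0 ^+ 2 + F 1 0 ^+ 2 = 1.
Proof.
move=> rF; have [eF oF] := rotations_entries F rF.
have E := det22 F; rewrite (proj2 rF) in E.
split; last by rewrite E eF oF; ring.
have [I0 I1] : (0 : 'I_2) = ord0 /\ (1 : 'I_2) = lift ord0 ord0.
  by split; apply/val_inj.
apply/matrixP => i j; rewrite !mxE; case: ifPn => [/eqP <-|].
  by case: (unliftP ord0 i) => [k ->|->]; rewrite ?ord1 -?I1 -?I0.
case: (unliftP ord0 i) (unliftP ord0 j) => [k ->|->] [l ->|->];
  by rewrite ?ord1 -?I1 -?I0 ?eqxx.
Qed.

Lemma conformal_continuous (c s : R -> R) :
  continuous c -> continuous s -> continuous (fun t => conformal (c t) (s t)).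
Proof.
move=> cc cs; apply: mx_continuous => i j t.
under eq_fun do rewrite mxE.
case: ifP => _; first exact: cc.
by case: ifP => _; [exact: (cvgN (cs t))|exact: cs].
Qed.

(** An arc of the unit circle joins the identity to F. The superset [A] allows the arc to be used
    both in [rotations] and in [body]. *)
Lemma connected_component_rotations (A : set 'M[R]_2) F :
  rotations `<=` A -> rotations F ->
  connected_component A (conformal 1 0) F.
Proof.
move=> sub /rotationsE[FE cs]; rewrite FE; clear FE.
move: (F 0 0) (F 1 0) cs => c s cs.
have c1 : -1 <= c <= 1.
  by rewrite -ler_norml -(ler_pXn2r (n := 2))// ?nnegrE// real_normK ?num_real//;
    have := sqr_ge0 s; lra.
(* The sign selects the upper or lower half circle, where the angle [acos c] is available. *)
pose e : R := if 0 <= s then 1 else -1.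
have e2 : e ^+ 2 = 1 by rewrite /e; case: ifP => _; ring.
have es : e * Num.sqrt (1 - c ^+ 2) = s.
  have -> : 1 - c ^+ 2 = s ^+ 2 by lra.
  rewrite sqrtr_sqr /e; case: ifPn => [s0|]; first by rewrite mul1r ger0_norm.
  by rewrite -ltNge => s0; rewrite ltr0_norm// mulrNN mul1r.
have := @path_connected_component R _ setT
  (fun t => conformal (cos t) (e * sin t)) A 0 (acos c).
rewrite cos0 sin0 mulr0 acosK ?sin_acos ?in_itv//= es; apply => //.
- by apply/connected_intervalP.
- apply: conformal_continuous => t; first exact: continuous_cos.
  exact: (cvgM (@cvg_cst _ _ _ _ _) (@continuous_sin R t)).
- move=> t _; apply/sub/rotations_conformal.
  by rewrite exprMn e2 mul1r cos2Dsin2.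
Qed.

Lemma connected_rotations : connected rotations.
Proof.
have -> : rotations = connected_component rotations (conformal 1 0).
  apply/seteqP; split => F; last exact: connected_component_sub.
  exact: connected_component_rotations.
exact: component_connected.
Qed.

(** Shrink w to t w with z fixed: det = |z|^2 - t^2 |w|^2 grows as t decreases, so the conditions of
    [body] persist. *)
Lemma connected_component_conformal F : body F ->
  connected_component body F
    (conformal ((F 0 0 + F 1 1) / 2) ((F 1 0 - F 0 1) / 2)).
Proof.
move=> [d z w]; set C := conformal _ _.
have := @path_connected_component R _ `[0, 1]%classic
  (fun t => C + t *: (F - C)) body 1 0.
have CF : C + (F - C) = F by rewrite addrC subrK.
rewrite scale1r scale0r addr0 CF; apply.
- exact: segment_connected.
- apply: mx_continuous => i j t.
  under eq_fun do rewrite !mxE.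
  exact: (cvgD (@cvg_cst _ _ _ _ _) (cvgM (@cvg_id _ _) (@cvg_cst _ _ _ _ _))).
- move=> t /=; rewrite in_itv /= => /andP[t0 t1].
  have t2 : t ^+ 2 <= 1 by rewrite expr_le1.
  move: d z w; rewrite /body !fro2E !det22 !mxE /=.
  move: (F _ _) (F _ _) (F _ _) (F _ _) => a b c e d z w.
  (* k is 4 |w|^2. *)
  set k := (e - c) ^+ 2 + (a + b) ^+ 2.
  have k0 : 0 <= k by rewrite addr_ge0 ?sqr_ge0.
  have tk : t ^+ 2 * k <= k by rewrite ler_piMl.
  set D := e * c - b * a in d z w; set Dt := _ * _ - _ * _.
  have DtE : Dt = D + (k - t ^+ 2 * k) / 4 by rewrite /Dt /D /k; field.
  have wt : 4 * (t ^+ 2 * k) <= (Dt - 1) ^+ 2.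
    have : (D - 1) ^+ 2 <= (Dt - 1) ^+ 2.
      by rewrite ler_pXn2r ?nnegrE//; lra.
    by have : 4 * k <= (D - 1) ^+ 2; [move: w; rewrite /D /k; lra|lra].
  split; first lra.
    by move: z; rewrite /Dt /D; lra.
  by apply: le_trans wt; rewrite /Dt /k; lra.
- by rewrite /= in_itv /= ler01 lexx.
- by rewrite /= in_itv /= ler01 lexx.
Qed.

(** Move z along its ray to the unit circle; |z| stays in [1, 5]. *)
Lemma connected_component_radial (c s : R) : 1 <= c ^+ 2 + s ^+ 2 <= 25 ->
  exists2 G, rotations G & connected_component body (conformal c s) G.
Proof.
set r2 := c ^+ 2 + s ^+ 2 => /andP[r1 r25].
pose r := Num.sqrt r2.
have r2E : r ^+ 2 = r2 by rewrite sqr_sqrtr// (le_trans ler01).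
have r0 : 0 <= r := sqrtr_ge0 _.
have r1' : 1 <= r by rewrite -(ler_pXn2r (n := 2))// ?nnegrE// expr1n r2E.
have r5 : r <= 5 by rewrite -(ler_pXn2r (n := 2))// ?nnegrE// r2E; lra.
have rN0 : r != 0 by rewrite gt_eqF// (lt_le_trans ltr01).
have r2N0 : r2 != 0 by rewrite -r2E expf_neq0.
have norm1 : (c / r) ^+ 2 + (s / r) ^+ 2 = 1.
  by rewrite !expr_div_n -mulrDl r2E divff.
exists (conformal (c / r) (s / r)); first exact: rotations_conformal.
have := @path_connected_component R _ `[1, 5]%classic
  (fun t => conformal (t * (c / r)) (t * (s / r))) body r 1.
rewrite !mul1r ![r * _]mulrC !divfK//; apply.
- exact: segment_connected.
- by apply: conformal_continuous => t;
    exact: (cvgM (@cvg_id _ _) (@cvg_cst _ _ _ _ _)).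
- move=> t /=; rewrite in_itv /= => /andP[t1 t5]; apply: body_conformal.
  have -> : (t * (c / r)) ^+ 2 + (t * (s / r)) ^+ 2 = t ^+ 2.
    by rewrite (exprMn _ t) (exprMn _ t (s / r)) -mulrDr norm1 mulr1.
  by nra.
- by rewrite /= in_itv /= r1'.
- by rewrite /= in_itv /= lexx; lra.
Qed.

(** Each F reaches the identity in three moves: remove w, scale z to modulus 1, rotate. *)
Lemma connected_body : connected body.
Proof.
have rot1 : rotations `<=` body by move=> F [].
have -> : body = connected_component body (conformal 1 0).
  apply/seteqP; split => F; last exact: connected_component_sub.
  move=> bF; have cF := connected_component_conformal F bF.
  have [|G rG cG] := connected_component_radial
    ((F 0 0 + F 1 1) / 2) ((F 1 0 - F 0 1) / 2).
    (* The modulus is admissible because |z|^2 = det F + |w|^2 >= 1. *)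
    case: bF => d z w; move: d z w; rewrite fro2E det22 => d z w.
    have := sqr_ge0 (F 0 0 - F 1 1); have := sqr_ge0 (F 1 0 + F 0 1).
    by move=> h1 h2; apply/andP; split; lra.
  apply: connected_component_trans (connected_component_rotations _ _ rot1 rG) _.
  exact/connected_component_sym/(connected_component_trans cF cG).
exact: component_connected.
Qed.


(** * Sublevel sets and failure of polyconvexity *)

Lemma sublevel_witness (c : R) :
  sublevel witness c =
    if c < 0 then set0 else if c < 1 then rotations else body.
Proof.
have body_gt0 F : body F -> 0 < \det F.
  by move=> [d _ _]; exact: lt_le_trans d.
apply/seteqP; split => F.
  move=> [_ Wc].
  have c0 : 0 <= c by rewrite -lee_fin (le_trans (witness_ge0 F)).
  rewrite ltNge c0 /=; have [bF|nF] := pselect (body F); last first.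
    by move: Wc; rewrite witness_out// leye_eq.
  case: ifPn => // c1; split => //; apply/eqP/negPn/negP => dF.
  by move: Wc; rewrite witness_body// lee_fin leNgt c1.
case: ltP => // c0; case: ltP => c1.
  by move=> rF; split; [case: rF => /body_gt0|rewrite witness_rotations].
move=> bF; split; first exact: body_gt0.
by rewrite (le_trans (witness_le1 F bF))// lee_fin.
Qed.

Lemma witness_not_polyconvex : ~ polyconvex witness.
Proof.
move=> [P [_ cvxP WP]].
pose K : 'M[R]_2 := delta_mx 0 0 - delta_mx 1 1.
(* [D a b] is diag(a + b, a - b), with z = a and w = b up to sign conventions of real numbers: the
   four matrices of the example are [D 1 0], [D 5 0], [D 3 1] and [D 3 (- 1)]. *)
pose D (a b : R) : 'M[R]_2 := a *: 1%:M + b *: K.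
have detD a b : \det (D a b) = a ^+ 2 - b ^+ 2.
  by rewrite det22 !mxE /=; ring.
have froD a b : fro2 (D a b) = 2 * (a ^+ 2 + b ^+ 2).
  by rewrite fro2E !mxE /=; ring.
have bD (a b : R) : 1 <= a ^+ 2 - b ^+ 2 -> a ^+ 2 <= 25 ->
    16 * b ^+ 2 <= (a ^+ 2 - b ^+ 2 - 1) ^+ 2 -> body (D a b).
  by move=> h1 h2 h3; rewrite /body detD froD; split; lra.
have PE (a b d : R) : d = a ^+ 2 - b ^+ 2 -> 0 < d -> P (D a b, d) = witness (D a b).
  by move=> -> d0; rewrite WP ?detD// /GLplus2 /= detD.
(* The last coordinate is kept free: the intermediate points (3 I, 13) and (3 I, 8) lie off the
   graph of det. *)
have cvxD (t a b d a' b' d' : R) : 0 <= t <= 1 ->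
    (P (D ((1 - t) * a + t * a') ((1 - t) * b + t * b'),
        (1 - t) * d + t * d')%R
      <= (1 - t)%:E * P (D a b, d) + t%:E * P (D a' b', d'))%E.
  move=> t01; apply: le_trans (cvxP t (D a b, d) (D a' b', d') t01).
  rewrite le_eqVlt; apply/orP; left; apply/eqP; congr P; congr pair.
  rewrite /= /D; move: {D detD froD bD PE} K => K.
  by rewrite !scalerDr !scalerA !scalerDl addrACA.
have P1 : P (D 1 0, 1) = 0%E.
  have r1 : rotations (D 1 0) by split; [apply: bD; lra|rewrite detD; lra].
  by rewrite -(witness_rotations _ r1); apply: PE; lra.
have Pbody (a b d : R) : d = a ^+ 2 - b ^+ 2 -> 1 < d -> a ^+ 2 <= 25 ->
    16 * b ^+ 2 <= (d - 1) ^+ 2 -> P (D a b, d) = 1%E.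
  move=> dE d1 z w; have b1 : body (D a b) by apply: bD; rewrite -?dE//; lra.
  by rewrite PE ?witness_body// ?detD -?dE ?gt_eqF//; lra.
have P5 : P (D 5 0, 25) = 1%E by apply: Pbody; lra.
have P31 : P (D 3 1, 8) = 1%E by apply: Pbody; lra.
have P31' : P (D 3 (- 1), 8) = 1%E by apply: Pbody; lra.
have P30 : P (D 3 0, 9) = 1%E by apply: Pbody; lra.
have half01 : 0 <= (1 / 2 : R) <= 1 by apply/andP; split; lra.
have le13 : (P (D 3 0, 13)%R <= (1 / 2)%:E)%E.
  have := cvxD (1 / 2) 1 0 1 5 0 25 half01.
  rewrite P1 P5 mule0 mule1 add0e.
  by congr (P (D _ _, _)%R <= _)%E; lra.
have le8 : (P (D 3 0, 8)%R <= 1)%E.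
  have := cvxD (1 / 2) 3 1 8 3 (-1) 8 half01.
  rewrite P31 P31' !mule1 -EFinD subrK.
  by congr (P (D _ _, _)%R <= _)%E; lra.
(* The weight 1/5 comes from 9 = 4/5 * 8 + 1/5 * 13. It yields P (3 I, 9) <= 4/5 + 1/10 = 9/10,
   against the value 1. *)
have := cvxD (1 / 5) 3 0 8 3 0 13.
rewrite (_ : (1 - 1 / 5) * 3 + 1 / 5 * 3 = 3); last by lra.
rewrite (_ : (1 - 1 / 5) * 0 + 1 / 5 * 0 = 0); last by lra.
rewrite (_ : (1 - 1 / 5) * 8 + 1 / 5 * 13 = 9); last by lra.
rewrite P30 => /(_ ltac:(apply/andP; split; lra)); apply/negP; rewrite -ltNge.
apply: (@le_lt_trans _ _ ((1 - 1 / 5)%:E * 1 + (1 / 5)%:E * (1 / 2)%:E)%E).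
  by apply: leeD; apply: lee_wpmul2l => //; rewrite lee_fin; lra.
by rewrite mule1 -EFinM -EFinD lte_fin; lra.
Qed.

End planar.

Theorem proposition1p2 (R : realType) :
  exists W : 'M[R]_2 -> \bar R,
    no_ninfty_on (@GLplus2 R) W /\
    objective_isotropic W /\
    rank_one_convex W /\
    (forall c : R, connected (sublevel W c) /\ compact (sublevel W c)) /\
    ~ polyconvex W.
Proof.
exists witness; split.
  by move=> F _; rewrite /witness; case: ifP => // _; case: ifP.
split; first exact: witness_objective_isotropic.
split; first exact: witness_rank_one_convex.
split; last exact: witness_not_polyconvex.
move=> c; rewrite sublevel_witness; case: ifP => _.
  by split; [exact: connected0|exact: compact0].
case: ifP => _.
  by split; [exact: connected_rotations|exact: compact_rotations].
by split; [exact: connected_body|exact: compact_body].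
Qed.
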